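(* The category $\mathcal{PMV}_1$ of (commutative) unitary $PMV$-algebras is coextensive.
   Context: An MV-algebra is $(A,\oplus,\neg,0)$ with $(A,\oplus,0)$ a commutative monoid, $\neg\neg x=x$, $x\oplus\neg 0=\neg 0$, $\neg(\neg x\oplus y)\oplus y=\neg(\neg y\oplus x)\oplus x$. Put $u=\neg 0$ and $x\ominus y=\neg(\neg x\oplus y)$. A unitary $PMV$-algebra ($PMV_1$-algebra) is an MV-algebra with an associative commutative product such that for all $a,b,c$: $au=a$ and $a(b\ominus c)=ab\ominus ac$. Morphisms of $\mathcal{PMV}_1$ are maps preserving $\oplus,\neg,0$ and the product. The terminal object is the one-element algebra $\{0\}$. A category $\mathcal C$ is coextensive if $\mathcal C^{op}$ is extensive. Explicitly, a category with finite products is coextensive if (1) for all objects $A,B$ the pushout of the two product projections $\pi_A:A\times B\to A$ and $\pi_B:A\times B\to B$ is the terminal object, and (2) for every morphism $g:A\times B\to C$ the pushout $C\to C_1$ of $\pi_A$ along $g$ and the pushout $C\to C_2$ of $\pi_B$ along $g$ exist, and $C\cong C_1\times C_2$ via the induced morphism. *)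

(* Defs.v *)
From Stdlib Require Import ProofIrrelevance.

Set Implicit Arguments.
Unset Strict Implicit.
Unset Printing Implicit Defensive.

(** * Categories *)

Record Category := {
  obj :> Type;
  hom : obj -> obj -> Type;
  idc : forall a, hom a a;
  comp : forall a b c, hom b c -> hom a b -> hom a c;
  comp_id_l : forall a b (f : hom a b), comp (idc b) f = f;
  comp_id_r : forall a b (f : hom a b), comp f (idc a) = f;
  comp_assoc : forall a b c d (h : hom c d) (g : hom b c) (f : hom a b),
    comp h (comp g f) = comp (comp h g) f
}.

Arguments hom {c0} _ _ : rename.
Arguments idc {c0} a : rename.
Arguments comp {c0 a b c} _ _ : rename.

Declare Scope cat_scope.
Delimit Scope cat_scope with cat.
Notation "g ∘ f" := (comp g f) (at level 40, left associativity) : cat_scope.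
Local Open Scope cat_scope.

Definition IsIso (C : Category) (a b : C) (f : hom a b) : Prop :=
  exists g : hom b a, g ∘ f = idc a /\ f ∘ g = idc b.

Record Terminal (C : Category) := {
  term_obj :> C;
  term_map : forall a : C, hom a term_obj;
  term_unique : forall (a : C) (f : hom a term_obj), f = term_map a
}.

Arguments term_map {C} _ a.

Record Product (C : Category) (a b : C) := {
  prod_obj :> C;
  proj1 : hom prod_obj a;
  proj2 : hom prod_obj b;
  pairing : forall c : C, hom c a -> hom c b -> hom c prod_obj;
  pairing_proj1 : forall c (f : hom c a) (g : hom c b),
    proj1 ∘ pairing f g = f;
  pairing_proj2 : forall c (f : hom c a) (g : hom c b),
    proj2 ∘ pairing f g = g;
  pairing_unique : forall c (f : hom c a) (g : hom c b) (h : hom c prod_obj),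
    proj1 ∘ h = f -> proj2 ∘ h = g -> h = pairing f g
}.

Arguments proj1 {C a b} _.
Arguments proj2 {C a b} _.
Arguments pairing {C a b} _ {c} _ _.

Definition HasFiniteProducts (C : Category) : Prop :=
  inhabited (Terminal C) /\ forall a b : C, inhabited (Product a b).

(** The square [i ∘ f = j ∘ g] is a pushout of [b <-f- a -g-> c]; [j] is then
    the pushout of [f] along [g]. *)
Definition IsPushout (C : Category) (a b c : C) (f : hom a b) (g : hom a c)
    (d : C) (i : hom b d) (j : hom c d) : Prop :=
  i ∘ f = j ∘ g /\
  forall (e : C) (x : hom b e) (y : hom c e), x ∘ f = y ∘ g ->
    exists! h : hom d e, h ∘ i = x /\ h ∘ j = y.

Definition HasPushout (C : Category) (a b c : C)
    (f : hom a b) (g : hom a c) : Prop :=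
  exists (d : C) (i : hom b d) (j : hom c d), IsPushout f g i j.

(** Products, terminal objects and pushouts are only determined up to
    isomorphism, so the two conditions are imposed on all of them. *)
Definition Coextensive (C : Category) : Prop :=
  HasFiniteProducts C /\
  (forall (a b : C) (p : Product a b) (t : Terminal C),
     IsPushout (proj1 p) (proj2 p) (term_map t a) (term_map t b)) /\
  (forall (a b : C) (p : Product a b) (c : C) (g : hom p c),
     HasPushout (proj1 p) g /\
     HasPushout (proj2 p) g /\
     forall (c1 c2 : C) (i1 : hom a c1) (j1 : hom c c1)
            (i2 : hom b c2) (j2 : hom c c2),
       IsPushout (proj1 p) g i1 j1 ->
       IsPushout (proj2 p) g i2 j2 ->
       forall q : Product c1 c2, IsIso (pairing q j1 j2)).

(** * MV-algebras and unitary PMV-algebras *)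

Declare Scope mv_scope.
Delimit Scope mv_scope with mv.
Reserved Notation "x ⊕ y" (at level 50, left associativity).
Reserved Notation "x ⊖ y" (at level 50, left associativity).
Reserved Notation "x ⋅ y" (at level 40, left associativity).
Reserved Notation "¬ x" (at level 35, right associativity).

Record MVAlgebra := {
  mv_carrier :> Type;
  oplus : mv_carrier -> mv_carrier -> mv_carrier
    where "x ⊕ y" := (oplus x y);
  neg : mv_carrier -> mv_carrier
    where "¬ x" := (neg x);
  zero : mv_carrier;
  oplus_assoc : forall x y z, x ⊕ (y ⊕ z) = (x ⊕ y) ⊕ z;
  oplus_comm : forall x y, x ⊕ y = y ⊕ x;
  oplus_zero : forall x, x ⊕ zero = x;
  neg_neg : forall x, ¬ ¬ x = x;
  oplus_neg_zero : forall x, x ⊕ ¬ zero = ¬ zero;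
  lukasiewicz : forall x y, ¬ (¬ x ⊕ y) ⊕ y = ¬ (¬ y ⊕ x) ⊕ x
}.

Arguments oplus {m} _ _ : rename.
Arguments neg {m} _ : rename.
Arguments zero {m} : rename.
Notation "x ⊕ y" := (oplus x y) : mv_scope.
Notation "¬ x" := (neg x) : mv_scope.
Local Open Scope mv_scope.

Definition unit_mv {A : MVAlgebra} : A := ¬ zero.
Definition ominus {A : MVAlgebra} (x y : A) : A := ¬ (¬ x ⊕ y).
Notation "x ⊖ y" := (ominus x y) : mv_scope.

Record PMV1Algebra := {
  pmv_mv :> MVAlgebra;
  mul : pmv_mv -> pmv_mv -> pmv_mv
    where "x ⋅ y" := (mul x y);
  mul_assoc : forall a b c, a ⋅ (b ⋅ c) = (a ⋅ b) ⋅ c;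
  mul_comm : forall a b, a ⋅ b = b ⋅ a;
  mul_unit : forall a, a ⋅ unit_mv = a;
  mul_ominus : forall a b c, a ⋅ (b ⊖ c) = (a ⋅ b) ⊖ (a ⋅ c)
}.

Arguments mul {p} _ _ : rename.
Notation "x ⋅ y" := (mul x y) : mv_scope.

Record IsPMV1Hom (A B : PMV1Algebra) (f : A -> B) : Prop := {
  hom_oplus : forall x y, f (x ⊕ y) = f x ⊕ f y;
  hom_neg : forall x, f (¬ x) = ¬ f x;
  hom_zero : f zero = zero;
  hom_mul : forall x y, f (x ⋅ y) = f x ⋅ f y
}.

Record PMV1Hom (A B : PMV1Algebra) := {
  pmv_fun :> A -> B;
  pmv_fun_hom : IsPMV1Hom pmv_fun
}.

Lemma PMV1Hom_eq (A B : PMV1Algebra) (f g : PMV1Hom A B) :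
  pmv_fun f = pmv_fun g -> f = g.
Proof.
destruct f as [f Hf], g as [g Hg]; simpl; intros <-.
now rewrite (proof_irrelevance _ Hf Hg).
Qed.

Lemma id_IsPMV1Hom (A : PMV1Algebra) : IsPMV1Hom (fun x : A => x).
Proof. now constructor. Qed.

Lemma comp_IsPMV1Hom (A B C : PMV1Algebra) (g : PMV1Hom B C) (f : PMV1Hom A B) :
  IsPMV1Hom (fun x => g (f x)).
Proof.
destruct f as [f [Hf1 Hf2 Hf3 Hf4]], g as [g [Hg1 Hg2 Hg3 Hg4]]; simpl.
constructor; intros.
- now rewrite Hf1, Hg1.
- now rewrite Hf2, Hg2.
- now rewrite Hf3, Hg3.
- now rewrite Hf4, Hg4.
Qed.

Definition PMV1_id (A : PMV1Algebra) : PMV1Hom A A :=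
  {| pmv_fun_hom := id_IsPMV1Hom A |}.

Definition PMV1_comp (A B C : PMV1Algebra) (g : PMV1Hom B C) (f : PMV1Hom A B) :
  PMV1Hom A C := {| pmv_fun_hom := comp_IsPMV1Hom g f |}.

Definition PMV1 : Category.
Proof.
refine {| obj := PMV1Algebra; hom := PMV1Hom; idc := PMV1_id; comp := PMV1_comp |};
  intros; apply PMV1Hom_eq; reflexivity.
Defined.

(* Main.v *)
From Stdlib Require Import ProofIrrelevance FunctionalExtensionality.
Require Import Defs.

Set Implicit Arguments.
Unset Strict Implicit.
Unset Printing Implicit Defensive.

Local Open Scope cat_scope.
Local Open Scope mv_scope.

(** The argument is the one for commutative rings: a decomposition of an algebra
    as a product is a complementary pair of idempotents, and morphisms carry such
    pairs to such pairs.

    Say that [f : P -> A] is a localization at an idempotent [e] when it is the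
    universal morphism out of [P] sending [e] to the unit.  The projections of a product are
    localizations at [(u, 0)] and [(0, u)] ([proj1_localization],
    [proj2_localization]), and every algebra [C] has a localization at every
    idempotent [e], namely [x ↦ e ⋅ x] onto the set of multiples of [e]
    ([corner_localization]).  By universality, the pushout along [g] of the
    localization at [e] is the localization at [g e] ([localization_pushout]).

    Both conditions follow.  The pushout of the two projections is a localization
    at [proj2 (u, 0) = 0], and the localization at [0] is the terminal algebra.
    Along [g], the two projections push out to the localizations of the codomain
    at [e = g (u, 0)] and at [¬ e]; together these present it as a product, as [x]
    is determined by [e ⋅ x] and [¬ e ⋅ x], which can be prescribed independently
    ([localizations_product]).

    Localizations are described by a section and by multiplication by [e] rather
    than by congruences, so that all the morphisms needed have explicit formulas. *)

(** * Arithmetic of unitary PMV-algebras *)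

Section Arithmetic.
Variable A : PMV1Algebra.
Implicit Types x y e : A.

Lemma zero_oplus x : zero ⊕ x = x.
Proof. rewrite oplus_comm; apply oplus_zero. Qed.

(** This is the Łukasiewicz axiom for [x] and the unit. *)
Lemma neg_oplus x : ¬ x ⊕ x = unit_mv.
Proof.
pose proof (lukasiewicz x (¬ zero)) as H.
rewrite oplus_neg_zero, neg_neg, zero_oplus in H.
now symmetry.
Qed.

Lemma ominus_diag x : x ⊖ x = zero.
Proof. unfold ominus; rewrite neg_oplus; apply neg_neg. Qed.

Lemma ominus_zero x : x ⊖ zero = x.
Proof. unfold ominus; rewrite oplus_zero; apply neg_neg. Qed.

(** Antisymmetry of the natural order: the Łukasiewicz axiom says that the join
    [(x ⊖ y) ⊕ y] is symmetric. *)
Lemma ominus_antisym x y : x ⊖ y = zero -> y ⊖ x = zero -> x = y.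
Proof.
unfold ominus; intros Hxy Hyx.
pose proof (lukasiewicz x y) as H.
rewrite Hxy, Hyx, !zero_oplus in H.
now symmetry.
Qed.

Lemma neg_ominus x : ¬ x = unit_mv ⊖ x.
Proof. unfold ominus, unit_mv; now rewrite neg_neg, zero_oplus. Qed.

Lemma oplus_ominus x y : x ⊕ y = ¬ (¬ x ⊖ y).
Proof. unfold ominus; now rewrite !neg_neg. Qed.

Lemma mul_zero x : x ⋅ zero = zero.
Proof.
rewrite <- (ominus_diag zero), mul_ominus.
now rewrite !ominus_diag.
Qed.

Lemma zero_mul x : zero ⋅ x = zero.
Proof. rewrite mul_comm; apply mul_zero. Qed.

Lemma unit_mul x : unit_mv ⋅ x = x.
Proof. rewrite mul_comm; apply mul_unit. Qed.

Lemma mul_neg e x : e ⋅ ¬ x = e ⊖ e ⋅ x.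
Proof. now rewrite neg_ominus, mul_ominus, mul_unit. Qed.

(** The MV-operations are terms in [⊖] and the unit; multiplication by [e]
    distributes over [⊖], which makes it a quotient map as soon as
    [e ⋅ e = e]. *)
Lemma mul_oplus e x y : e ⋅ (x ⊕ y) = e ⊖ ((e ⊖ e ⋅ x) ⊖ e ⋅ y).
Proof. now rewrite oplus_ominus, mul_neg, mul_ominus, mul_neg. Qed.

Section Idempotent.
Variable e : A.
Hypothesis He : e ⋅ e = e.

Lemma idem_mul_mul x : e ⋅ (e ⋅ x) = e ⋅ x.
Proof. now rewrite mul_assoc, He. Qed.

Lemma idem_oplus_l x y : e ⋅ (e ⋅ x ⊕ y) = e ⋅ (x ⊕ y).
Proof. now rewrite !mul_oplus, idem_mul_mul. Qed.

Lemma idem_oplus_r x y : e ⋅ (x ⊕ e ⋅ y) = e ⋅ (x ⊕ y).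
Proof. now rewrite !mul_oplus, idem_mul_mul. Qed.

Lemma idem_neg x : e ⋅ ¬ (e ⋅ x) = e ⋅ ¬ x.
Proof. now rewrite !mul_neg, idem_mul_mul. Qed.

Lemma idem_mul_neg : e ⋅ ¬ e = zero.
Proof. now rewrite mul_neg, He, ominus_diag. Qed.

End Idempotent.

Lemma idem_compl e : e ⋅ e = e -> ¬ e ⋅ ¬ e = ¬ e.
Proof.
intros He.
now rewrite mul_neg, (mul_comm (¬ e) e), idem_mul_neg, ominus_zero.
Qed.

(** The difference [z = x ⊖ y] is killed by [e] and by [¬ e], while
    [¬ e ⋅ z = z ⊖ e ⋅ z]. *)
Lemma compl_joint_injective e x y :
  e ⋅ x = e ⋅ y -> ¬ e ⋅ x = ¬ e ⋅ y -> x = y.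
Proof.
assert (Hle : forall x y : A,
          e ⋅ x = e ⋅ y -> ¬ e ⋅ x = ¬ e ⋅ y -> x ⊖ y = zero).
{ intros a b H1 H2.
  assert (K1 : e ⋅ (a ⊖ b) = zero) by now rewrite mul_ominus, H1, ominus_diag.
  assert (K2 : ¬ e ⋅ (a ⊖ b) = zero) by now rewrite mul_ominus, H2, ominus_diag.
  rewrite mul_comm, mul_neg, (mul_comm _ e), K1, ominus_zero in K2.
  exact K2. }
intros H1 H2; apply ominus_antisym; apply Hle; congruence.
Qed.

Lemma compl_glue e x y :
  e ⋅ e = e -> e ⋅ (e ⋅ x ⊕ ¬ e ⋅ y) = e ⋅ x.
Proof.
intros He.
rewrite idem_oplus_l, <- idem_oplus_r, mul_assoc, idem_mul_neg by assumption.
now rewrite zero_mul, oplus_zero.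
Qed.

End Arithmetic.

Lemma hom_unit (A B : PMV1Algebra) (f : PMV1Hom A B) : f unit_mv = unit_mv.
Proof.
unfold unit_mv.
now rewrite (hom_neg (pmv_fun_hom f)), (hom_zero (pmv_fun_hom f)).
Qed.

Lemma PMV1Hom_ext (A B : PMV1Algebra) (f g : PMV1Hom A B) :
  (forall x, f x = g x) -> f = g.
Proof. intros H; apply PMV1Hom_eq, functional_extensionality, H. Qed.

Lemma PMV1Hom_app (A B : PMV1Algebra) (f g : PMV1Hom A B) (x : A) :
  f = g -> f x = g x.
Proof. now intros ->. Qed.

Lemma bijective_IsIso (A B : PMV1Algebra) (f : PMV1Hom A B) (s : B -> A) :
  (forall x, s (f x) = x) -> (forall y, f (s y) = y) -> @IsIso PMV1 A B f.
Proof.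
intros Hsf Hfs.
assert (Hs : IsPMV1Hom s).
{ pose proof (pmv_fun_hom f) as Hf.
  constructor; [intros x y|intros x| |intros x y].
  - now rewrite <- (Hfs x), <- (Hfs y), <- (hom_oplus Hf), !Hsf.
  - now rewrite <- (Hfs x), <- (hom_neg Hf), !Hsf.
  - now rewrite <- (hom_zero Hf), Hsf.
  - now rewrite <- (Hfs x), <- (Hfs y), <- (hom_mul Hf), !Hsf. }
exists {| pmv_fun_hom := Hs |}.
split; apply PMV1Hom_ext; assumption.
Qed.

(** * Finite products *)

Definition one_MV : MVAlgebra.
Proof.
refine {| mv_carrier := unit; oplus := fun _ _ => tt; neg := fun _ => tt;
          zero := tt |};
  intros; repeat match goal with x : unit |- _ => destruct x end; reflexivity.
Defined.

Definition one_PMV1 : PMV1Algebra.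
Proof.
refine {| pmv_mv := one_MV; mul := fun _ _ => tt |};
  intros; repeat match goal with x : mv_carrier one_MV |- _ => destruct x end;
  reflexivity.
Defined.

Definition to_one (A : PMV1Algebra) : PMV1Hom A one_PMV1.
Proof. refine {| pmv_fun := fun _ : A => tt : one_PMV1 |}; now constructor. Defined.

Lemma to_one_unique (A : PMV1Algebra) (f : PMV1Hom A one_PMV1) : f = to_one A.
Proof. apply PMV1Hom_ext; intros x; simpl; now destruct (f x). Qed.

Definition one_Terminal : Terminal PMV1 :=
  @Build_Terminal PMV1 one_PMV1 to_one to_one_unique.

Definition prod_MV (A B : MVAlgebra) : MVAlgebra.
Proof.
refine {| mv_carrier := (A * B)%type;
          oplus := fun x y => (fst x ⊕ fst y, snd x ⊕ snd y);
          neg := fun x => (¬ fst x, ¬ snd x);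
          zero := (zero, zero) |};
  intros; simpl; try match goal with |- _ = ?x => rewrite (surjective_pairing x) end;
  simpl; f_equal;
  apply oplus_assoc || apply oplus_comm || apply oplus_zero || apply neg_neg
  || apply oplus_neg_zero || apply lukasiewicz.
Defined.

Definition prod_PMV1 (A B : PMV1Algebra) : PMV1Algebra.
Proof.
refine {| pmv_mv := prod_MV A B;
          mul := fun x y : prod_MV A B => (fst x ⋅ fst y, snd x ⋅ snd y)
                                          : prod_MV A B |};
  intros; simpl; try match goal with |- _ = ?x => rewrite (surjective_pairing x) end;
  simpl; f_equal;
  apply mul_assoc || apply mul_comm || apply mul_unit || apply mul_ominus.
Defined.

Definition prod_fst (A B : PMV1Algebra) : PMV1Hom (prod_PMV1 A B) A.
Proof. refine {| pmv_fun := fun x : prod_PMV1 A B => fst x |}; now constructor. Defined.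

Definition prod_snd (A B : PMV1Algebra) : PMV1Hom (prod_PMV1 A B) B.
Proof. refine {| pmv_fun := fun x : prod_PMV1 A B => snd x |}; now constructor. Defined.

Definition prod_pair (A B C : PMV1Algebra) (f : PMV1Hom C A) (g : PMV1Hom C B) :
  PMV1Hom C (prod_PMV1 A B).
Proof.
refine {| pmv_fun := fun x => (f x, g x) : prod_PMV1 A B |}.
destruct (pmv_fun_hom f), (pmv_fun_hom g).
constructor; intros; simpl; f_equal; auto.
Defined.

Definition prod_Product (A B : PMV1) : Product A B.
Proof.
refine (@Build_Product PMV1 A B (prod_PMV1 A B) (prod_fst A B) (prod_snd A B)
          (fun C f g => prod_pair f g) _ _ _).
- intros C f g; now apply PMV1Hom_ext.
- intros C f g; now apply PMV1Hom_ext.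
- intros C f g h <- <-; apply PMV1Hom_ext; intros x; apply surjective_pairing.
Defined.

(** Any terminal object is a retract of the one-element algebra. *)
Lemma terminal_trivial (T : Terminal PMV1) (x y : pmv_mv (term_obj T)) : x = y.
Proof.
assert (H : forall k : PMV1Hom one_PMV1 (term_obj T), forall z, z = k tt).
{ intros k z.
  assert (E : idc (term_obj T) = (k : @hom PMV1 _ _) ∘ to_one (term_obj T))
    by (rewrite (term_unique (idc _)); symmetry; apply term_unique).
  exact (PMV1Hom_app z E). }
set (k := term_map T one_PMV1 : PMV1Hom _ _).
rewrite (H k x); symmetry; apply H.
Qed.

(** Products are given abstractly, but their elements are pairs. *)
Lemma product_elements (A B : PMV1) (p : Product A B) :
  exists mk : pmv_mv A -> pmv_mv B -> pmv_mv (prod_obj p),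
    (forall a b, (proj1 p : PMV1Hom _ _) (mk a b) = a) /\
    (forall a b, (proj2 p : PMV1Hom _ _) (mk a b) = b) /\
    forall x, x = mk ((proj1 p : PMV1Hom _ _) x) ((proj2 p : PMV1Hom _ _) x).
Proof.
set (q := prod_Product A B).
set (k := pairing p (proj1 q) (proj2 q) : PMV1Hom (prod_PMV1 A B) _).
exists (fun a b => k (a, b)).
split; [|split].
- intros a b; exact (PMV1Hom_app ((a, b) : prod_PMV1 A B)
                       (pairing_proj1 p (proj1 q) (proj2 q))).
- intros a b; exact (PMV1Hom_app ((a, b) : prod_PMV1 A B)
                       (pairing_proj2 p (proj1 q) (proj2 q))).
- intros x.
  assert (E : idc (prod_obj p) = (k : hom q p) ∘ pairing q (proj1 p) (proj2 p)).
  { transitivity (pairing p (proj1 p) (proj2 p));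
      [|symmetry]; apply pairing_unique.
    - apply comp_id_r.
    - apply comp_id_r.
    - now rewrite comp_assoc; unfold k; rewrite !pairing_proj1.
    - now rewrite comp_assoc; unfold k; rewrite !pairing_proj2. }
  exact (PMV1Hom_app x E).
Qed.

(** * Localizations *)

(** A morphism sending [e] to the unit identifies [x] and [y] whenever
    [e ⋅ x = e ⋅ y]; the last clause says that [f] identifies nothing more, which
    makes it universal among these morphisms ([loc_factor], [loc_epi]).  It also
    forces [e] to be idempotent ([loc_idem]).  Surjectivity is witnessed by a section so
    that the factorizations through [f] are given by formulas. *)
Record IsLocalization (P A : PMV1Algebra) (f : PMV1Hom P A) (e : P) : Prop := {
  loc_section : exists s : A -> P, forall a, f (s a) = a;
  loc_unit : f e = unit_mv;
  loc_kernel : forall x y, f x = f y -> e ⋅ x = e ⋅ y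
}.

Lemma loc_idem (P A : PMV1Algebra) (f : PMV1Hom P A) (e : P) :
  IsLocalization f e -> e ⋅ e = e.
Proof.
intros Hf; transitivity (e ⋅ unit_mv); [|apply mul_unit].
apply (loc_kernel Hf).
now rewrite (loc_unit Hf), hom_unit.
Qed.

Lemma unit_image_mul (P E : PMV1Algebra) (f : PMV1Hom P E) (e x : P) :
  f e = unit_mv -> f (e ⋅ x) = f x.
Proof. intros H; now rewrite (hom_mul (pmv_fun_hom f)), H, unit_mul. Qed.

Lemma loc_factor (P A E : PMV1Algebra) (f : PMV1Hom P A) (e : P)
    (y : PMV1Hom P E) :
  IsLocalization f e -> y e = unit_mv ->
  exists h : PMV1Hom A E, forall x, h (f x) = y x.
Proof.
intros Hf Hy.
destruct (loc_section Hf) as [s Hs].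
assert (Hker : forall x x', f x = f x' -> y x = y x').
{ intros x x' H.
  rewrite <- (unit_image_mul x Hy), <- (unit_image_mul x' Hy).
  f_equal; now apply (loc_kernel Hf). }
pose proof (pmv_fun_hom f) as Ff.
pose proof (pmv_fun_hom y) as Fy.
assert (Hh : IsPMV1Hom (fun a => y (s a))).
{ constructor; [intros a b|intros a| |intros a b].
  - rewrite <- (hom_oplus Fy); apply Hker.
    now rewrite (hom_oplus Ff), !Hs.
  - rewrite <- (hom_neg Fy); apply Hker.
    now rewrite (hom_neg Ff), !Hs.
  - rewrite <- (hom_zero Fy); apply Hker.
    now rewrite (hom_zero Ff), Hs.
  - rewrite <- (hom_mul Fy); apply Hker.
    now rewrite (hom_mul Ff), !Hs. }
exists {| pmv_fun_hom := Hh |}.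
intros x; apply Hker, Hs.
Qed.

Lemma loc_epi (P A E : PMV1Algebra) (f : PMV1Hom P A) (e : P)
    (h k : PMV1Hom A E) :
  IsLocalization f e -> (forall x, h (f x) = k (f x)) -> h = k.
Proof.
intros Hf H; destruct (loc_section Hf) as [s Hs].
apply PMV1Hom_ext; intros a; rewrite <- (Hs a); apply H.
Qed.

(** A morphism out of the pushout is a morphism [y] out of [C] such that [y ∘ g]
    factors through [f], that is, such that [y (g e)] is the unit. *)
Lemma localization_pushout (P A C D : PMV1Algebra) (f : PMV1Hom P A) (e : P)
    (g : PMV1Hom P C) (i : PMV1Hom A D) (j : PMV1Hom C D) :
  IsLocalization f e -> IsLocalization j (g e) ->
  (forall x, i (f x) = j (g x)) ->
  @IsPushout PMV1 P A C f g D i j.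
Proof.
intros Hf Hj Hij; split; [now apply PMV1Hom_ext|].
intros E x y Hxy.
pose proof (fun z => PMV1Hom_app z Hxy) as Hxy'; cbn in x, y, Hxy'.
assert (Hy : y (g e) = unit_mv).
{ now rewrite <- (Hxy' e), (loc_unit Hf), hom_unit. }
destruct (loc_factor Hj Hy) as [h Hh].
exists h; split; [split|].
- apply (loc_epi Hf); intros z; simpl.
  now rewrite Hij, Hh, (Hxy' z).
- now apply PMV1Hom_ext.
- intros h' [_ H2]; apply (loc_epi Hj); intros z.
  rewrite Hh; symmetry; exact (PMV1Hom_app z H2).
Qed.

Lemma proj1_localization (A B : PMV1) (p : Product A B)
    (e : pmv_mv (prod_obj p)) :
  (proj1 p : PMV1Hom _ _) e = unit_mv -> (proj2 p : PMV1Hom _ _) e = zero ->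
  @IsLocalization (prod_obj p) A (proj1 p) e.
Proof.
intros H1 H2.
destruct (product_elements p) as (mk & M1 & M2 & M).
split.
- exists (fun a => mk a zero); intros a; apply M1.
- exact H1.
- intros x y Hxy.
  rewrite (M (e ⋅ x)), (M (e ⋅ y)).
  rewrite !(hom_mul (pmv_fun_hom (proj1 p))), !(hom_mul (pmv_fun_hom (proj2 p))).
  now rewrite Hxy, H2, !zero_mul.
Qed.

Lemma proj2_localization (A B : PMV1) (p : Product A B)
    (e : pmv_mv (prod_obj p)) :
  (proj1 p : PMV1Hom _ _) e = zero -> (proj2 p : PMV1Hom _ _) e = unit_mv ->
  @IsLocalization (prod_obj p) B (proj2 p) e.
Proof.
intros H1 H2.
destruct (product_elements p) as (mk & M1 & M2 & M).
split.
- exists (fun b => mk zero b); intros b; apply M2.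
- exact H2.
- intros x y Hxy.
  rewrite (M (e ⋅ x)), (M (e ⋅ y)).
  rewrite !(hom_mul (pmv_fun_hom (proj1 p))), !(hom_mul (pmv_fun_hom (proj2 p))).
  now rewrite Hxy, H1, !zero_mul.
Qed.

Lemma terminal_localization (A : PMV1) (T : Terminal PMV1) :
  @IsLocalization A (term_obj T) (term_map T A) zero.
Proof.
split.
- exists (fun _ => zero); intros a; apply terminal_trivial.
- apply terminal_trivial.
- intros x y _; now rewrite !zero_mul.
Qed.

(** ** The localization at an idempotent *)

Section Corner.
Variables (C : PMV1Algebra) (e : C).
Hypothesis He : e ⋅ e = e.

Definition corner_carrier : Type := {x : C | e ⋅ x = x}.

Definition corner_elt (x : C) : corner_carrier :=
  exist _ (e ⋅ x) (idem_mul_mul He x).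

Definition corner_oplus (x y : corner_carrier) : corner_carrier :=
  corner_elt (proj1_sig x ⊕ proj1_sig y).
Definition corner_neg (x : corner_carrier) : corner_carrier :=
  corner_elt (¬ proj1_sig x).
Definition corner_mul (x y : corner_carrier) : corner_carrier :=
  corner_elt (proj1_sig x ⋅ proj1_sig y).

Lemma corner_ext (x y : corner_carrier) : proj1_sig x = proj1_sig y -> x = y.
Proof.
destruct x as [x Hx], y as [y Hy]; simpl.
apply subset_eq_compat.
Qed.

Lemma corner_elt_sig (x : corner_carrier) : corner_elt (proj1_sig x) = x.
Proof. apply corner_ext; exact (proj2_sig x). Qed.

Lemma corner_elt_oplus (x y : C) :
  corner_oplus (corner_elt x) (corner_elt y) = corner_elt (x ⊕ y).
Proof. apply corner_ext; simpl; now rewrite idem_oplus_l, idem_oplus_r. Qed.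

Lemma corner_elt_neg (x : C) : corner_neg (corner_elt x) = corner_elt (¬ x).
Proof. apply corner_ext; simpl; now apply idem_neg. Qed.

Lemma corner_elt_mul (x y : C) :
  corner_mul (corner_elt x) (corner_elt y) = corner_elt (x ⋅ y).
Proof.
apply corner_ext; simpl.
rewrite (mul_assoc e (e ⋅ x)), idem_mul_mul by assumption.
rewrite <- (mul_assoc e x), (mul_comm x (e ⋅ y)), <- (mul_assoc e y).
now rewrite idem_mul_mul, (mul_comm y).
Qed.

(** Identities hold in the corner because it is the image of [corner_elt], which
    commutes with the operations. *)
Ltac corner_identity law :=
  intros;
  repeat match goal with
  | x : corner_carrier |- _ =>
      rewrite <- (corner_elt_sig x); generalize (proj1_sig x); clear x; intros
  end;
  repeat (rewrite corner_elt_oplus || rewrite corner_elt_neg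
          || rewrite corner_elt_mul);
  f_equal; apply law.

Definition corner_MV : MVAlgebra.
Proof.
refine {| mv_carrier := corner_carrier; oplus := corner_oplus;
          neg := corner_neg; zero := corner_elt zero |}.
- corner_identity (@oplus_assoc C).
- corner_identity (@oplus_comm C).
- corner_identity (@oplus_zero C).
- corner_identity (@neg_neg C).
- corner_identity (@oplus_neg_zero C).
- corner_identity (@lukasiewicz C).
Defined.

Definition corner_PMV1 : PMV1Algebra.
Proof.
refine {| pmv_mv := corner_MV; mul := corner_mul : _ -> _ -> corner_MV |};
  unfold unit_mv, ominus; simpl.
- corner_identity (@mul_assoc C).
- corner_identity (@mul_comm C).
- corner_identity (@mul_unit C).
- corner_identity (@mul_ominus C).
Defined.

Definition corner_hom : PMV1Hom C corner_PMV1.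
Proof.
refine {| pmv_fun := corner_elt : C -> corner_PMV1 |}.
constructor; intros; symmetry.
- apply corner_elt_oplus.
- apply corner_elt_neg.
- reflexivity.
- apply corner_elt_mul.
Defined.

Lemma corner_localization : IsLocalization corner_hom e.
Proof.
split.
- exists (fun x => proj1_sig x); exact corner_elt_sig.
- apply corner_ext; simpl.
  fold (@unit_mv C); rewrite (idem_neg He), He.
  symmetry; apply mul_unit.
- intros x y H; exact (f_equal (fun z => proj1_sig z) H).
Qed.

End Corner.

(** * Pushouts of localizations *)

Lemma pushout_unique (K : Category) (a b c : K) (f : hom a b) (g : hom a c)
    (d d' : K) (i : hom b d) (j : hom c d) (i' : hom b d') (j' : hom c d') :
  IsPushout f g i j -> IsPushout f g i' j' ->
  exists (k : hom d d') (k' : hom d' d),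
    k' ∘ k = idc d /\ k ∘ j = j' /\ k' ∘ j' = j.
Proof.
intros [Hsq Huniv] [Hsq' Huniv'].
destruct (Huniv d' i' j' Hsq') as (k & [Hi Hj] & _).
destruct (Huniv' d i j Hsq) as (k' & [Hi' Hj'] & _).
exists k, k'; split; [|now split].
destruct (Huniv d i j Hsq) as (h & _ & Hh).
transitivity h; [symmetry|]; apply Hh; split.
- now rewrite <- comp_assoc, Hi.
- now rewrite <- comp_assoc, Hj.
- apply comp_id_l.
- apply comp_id_l.
Qed.

Section Pushouts.
Variables (P A C : PMV1Algebra) (f : PMV1Hom P A) (e : P) (g : PMV1Hom P C).
Hypothesis Hf : IsLocalization f e.

Lemma localization_has_pushout :
  exists (D : PMV1Algebra) (i : PMV1Hom A D) (j : PMV1Hom C D),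
    IsLocalization j (g e) /\ @IsPushout PMV1 P A C f g D i j.
Proof.
assert (He : g e ⋅ g e = g e).
{ now rewrite <- (hom_mul (pmv_fun_hom g)), (loc_idem Hf). }
pose proof (corner_localization He) as Hj.
destruct (loc_factor (y := PMV1_comp (corner_hom He) g) Hf (loc_unit Hj))
  as [i Hi].
exists (corner_PMV1 He), i, (corner_hom He).
split; [exact Hj|].
now apply (localization_pushout Hf Hj).
Qed.

(** Pushouts are unique up to isomorphism, and being a localization is invariant
    under isomorphism. *)
Lemma pushout_localization (D : PMV1Algebra) (i : PMV1Hom A D) (j : PMV1Hom C D) :
  @IsPushout PMV1 P A C f g D i j -> IsLocalization j (g e).
Proof.
intros H.
destruct localization_has_pushout as (D' & i' & j' & Hj' & H').
destruct (pushout_unique H H') as (k & k' & Hk'k & Hk & Hk').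
pose proof (fun x => PMV1Hom_app x Hk'k) as K0; cbn in k, k', K0.
pose proof (fun x => PMV1Hom_app x Hk) as K; cbn in K.
pose proof (fun x => PMV1Hom_app x Hk') as K'; cbn in K'.
destruct (loc_section Hj') as [s Hs].
split.
- exists (fun d => s (k d)); intros d.
  now rewrite <- K', Hs, K0.
- now rewrite <- K', (loc_unit Hj'), hom_unit.
- intros x y Hxy; apply (loc_kernel Hj').
  now rewrite <- !K, Hxy.
Qed.

End Pushouts.

(** The inverse glues [x] and [y] to [e ⋅ x ⊕ ¬ e ⋅ y]. *)
Lemma localizations_product (C C1 C2 : PMV1Algebra) (e : C)
    (j1 : PMV1Hom C C1) (j2 : PMV1Hom C C2) (q : @Product PMV1 C1 C2) :
  IsLocalization j1 e -> IsLocalization j2 (¬ e) ->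
  @IsIso PMV1 C q (pairing q (j1 : @hom PMV1 _ _) (j2 : @hom PMV1 _ _)).
Proof.
intros H1 H2.
pose proof (loc_idem H1) as He.
destruct (loc_section H1) as [s1 Hs1], (loc_section H2) as [s2 Hs2].
destruct (product_elements q) as (mk & M1 & M2 & M).
set (k := pairing q _ _ : PMV1Hom C (prod_obj q)).
assert (K1 : forall x, (proj1 q : PMV1Hom _ _) (k x) = j1 x)
  by (intros x; exact (PMV1Hom_app x (pairing_proj1 q _ _))).
assert (K2 : forall x, (proj2 q : PMV1Hom _ _) (k x) = j2 x)
  by (intros x; exact (PMV1Hom_app x (pairing_proj2 q _ _))).
set (glue := fun x y : C => e ⋅ x ⊕ ¬ e ⋅ y).
assert (G1 : forall x y, e ⋅ glue x y = e ⋅ x)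
  by (intros x y; now apply compl_glue).
assert (G2 : forall x y, ¬ e ⋅ glue x y = ¬ e ⋅ y).
{ intros x y; unfold glue; rewrite oplus_comm.
  pose proof (compl_glue y x (idem_compl He)) as G.
  now rewrite neg_neg in G. }
apply (bijective_IsIso (f := k)
  (s := fun z => glue (s1 ((proj1 q : PMV1Hom _ _) z))
                      (s2 ((proj2 q : PMV1Hom _ _) z)))).
- intros x; rewrite K1, K2.
  apply (compl_joint_injective (e := e)).
  + rewrite G1; apply (loc_kernel H1), Hs1.
  + rewrite G2; apply (loc_kernel H2), Hs2.
- intros z; rewrite (M (k _)), K1, K2.
  transitivity (mk ((proj1 q : PMV1Hom _ _) z) ((proj2 q : PMV1Hom _ _) z));
    [|symmetry; apply M].
  f_equal.
  + rewrite <- (unit_image_mul _ (loc_unit H1)), G1.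
    rewrite (unit_image_mul _ (loc_unit H1)); apply Hs1.
  + rewrite <- (unit_image_mul _ (loc_unit H2)), G2.
    rewrite (unit_image_mul _ (loc_unit H2)); apply Hs2.
Qed.

Theorem mainTheorem4 : Coextensive PMV1.
Proof.
split; [|split].
- split; [exact (inhabits one_Terminal)|].
  intros A B; exact (inhabits (prod_Product A B)).
- intros A B p T.
  destruct (product_elements p) as (mk & M1 & M2 & _).
  apply (localization_pushout
           (proj1_localization (M1 unit_mv zero) (M2 unit_mv zero))).
  + rewrite M2; apply terminal_localization.
  + intros x; apply terminal_trivial.
- intros A B p C g.
  destruct (product_elements p) as (mk & M1 & M2 & _).
  set (e := mk unit_mv zero).
  assert (L1 : IsLocalization _ e)
    by exact (proj1_localization (M1 unit_mv zero) (M2 unit_mv zero)).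
  assert (L2 : @IsLocalization (prod_obj p) B (proj2 p) (¬ e)).
  { apply proj2_localization.
    - unfold e; rewrite (hom_neg (pmv_fun_hom (proj1 p))), M1; apply neg_neg.
    - unfold e; now rewrite (hom_neg (pmv_fun_hom (proj2 p))), M2. }
  split; [|split].
  + destruct (localization_has_pushout g L1) as (D & i & j & _ & H).
    now exists D, i, j.
  + destruct (localization_has_pushout g L2) as (D & i & j & _ & H).
    now exists D, i, j.
  + intros c1 c2 i1 j1 i2 j2 H1 H2 q.
    apply (localizations_product q (pushout_localization L1 H1)).
    rewrite <- (hom_neg (pmv_fun_hom g)).
    exact (pushout_localization L2 H2).
Qed.
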